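(* Let $H=(V,E)$ be a connected hypergraph with $|V|\ge 2$, in which every edge has cardinality at least $2$ and every vertex has degree at least $2$. Then the following are equivalent: (1) $H$ has no separating vertices and no cut edges; (2) every pair of distinct elements from $V\cup E$ lie on a common cycle; (3) every pair of distinct vertices lie on a common cycle; (4) every pair of distinct edges lie on a common cycle.
   Context: A hypergraph $H=(V,E)$ consists of a nonempty finite vertex set $V$, a finite edge set $E$, and an incidence function $\psi:E\to 2^V$; edges are identified with their vertex sets (parallel edges allowed); the degree of a vertex is the number of edges containing it. Two distinct vertices are adjacent via $e$ if both lie in $e$; a walk is a sequence $v_0e_1v_1\dots e_kv_k$ with $v_{i-1},v_i$ adjacent via $e_i$; $H$ is connected if any two distinct vertices are joined by a walk. A cycle is a walk $v_0e_1v_1\dots e_kv_k$ with $k\ge2$, $v_0=v_k$, $v_0,\dots,v_{k-1}$ pairwise distinct and $e_1,\dots,e_k$ pairwise distinct; a vertex (edge) lies on it if it is one of the $v_i$ (one of the $e_i$). For an equivalence class $V'$ of ''joined by a walk'', the connected component is $(V',\{f\in E:\emptyset\ne f\subseteq V'\})$; $\omega(H)$ is the number of components. $H-e=(V,E\setminus\{e\})$; $e$ is a cut edge if $\omega(H-e)>\omega(H)$. A hypersubgraph is $(V',E')$ with $V'\subseteq V$, $E'\subseteq E$. A vertex $v$ is a separating vertex of $H$ if there are two connected hypersubgraphs $H_1,H_2$, each with at least one edge, with $E(H_1)\cap E(H_2)=\emptyset$, $V=V(H_1)\cup V(H_2)$, $E=E(H_1)\cup E(H_2)$, and $V(H_1)\cap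 V(H_2)=\{v\}$. *)

(* Defs.v *)
From mathcomp Require Import all_boot.
Set Implicit Arguments.
Unset Strict Implicit.
Unset Printing Implicit Defensive.

(* The vertex and edge sets are subsets of ambient finite types T and U, so that
   H - e and the hypersubgraphs of H live over the same T and U as H. Edges are
   labels, which allows parallel edges; the values of [inc] outside [edges] are
   irrelevant. *)
Record hypergraph (T U : finType) := Hypergraph {
  verts : {set T};
  edges : {set U};
  inc : U -> {set T};
  verts_neq0 : verts != set0;
  inc_sub : forall e, e \in edges -> inc e \subset verts
}.

Section Hypergraph.
Variables T U : finType.
Implicit Types (H : hypergraph T U) (u v : T) (e : U) (w : seq (U * T)).

Definition degree H v : nat := #|[set e in edges H | v \in inc H e]|.

Definition adj_via H e u v : bool :=
  [&& e \in edges H, u != v, u \in inc H e & v \in inc H e].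

(* The walk v0 e1 v1 ... ek vk is encoded by v0 and
   w = [:: (e1, v1); ...; (ek, vk)]. *)
Fixpoint walk H v0 w : bool :=
  if w is (e, v) :: w' then adj_via H e v0 v && walk H v w'
  else v0 \in verts H.

Definition walk_end v0 w : T := last v0 (unzip2 w).

Definition joined H u v : Prop := exists w, walk H u w /\ walk_end u w = v.

Definition connected H : Prop :=
  forall u v, u \in verts H -> v \in verts H -> u != v -> joined H u v.

(* [belast v0 (unzip2 w)] is v0, ..., v(k-1). *)
Definition is_cycle H v0 w : bool :=
  [&& walk H v0 w, 2 <= size w, walk_end v0 w == v0,
      uniq (belast v0 (unzip2 w)) & uniq (unzip1 w)].

Definition lies_on v0 w (x : T + U) : bool :=
  match x with
  | inl v => v \in v0 :: unzip2 w
  | inr e => e \in unzip1 w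
  end.

Definition elements H : {set T + U} :=
  [set x : T + U | match x with
                   | inl v => v \in verts H
                   | inr e => e \in edges H
                   end].

Definition on_common_cycle H (x y : T + U) : Prop :=
  exists v0 w, [/\ is_cycle H v0 w, lies_on v0 w x & lies_on v0 w y].

(* A decidable form of [joined], used for counting; see [joinedP]. *)
Definition joinedb H : rel T :=
  connect (fun u v => [exists e, adj_via H e u v]).

Lemma joinedP H u v :
  u \in verts H -> reflect (joined H u v) (joinedb H u v).
Proof.
move=> uV; apply: (iffP connectP) => [[p]|[w]].
  elim: p u uV => [|x p IHp] u uV /=; first by move=> _ ->; exists [::].
  case/andP=> /existsP[e ux] xp vE.
  have xV : x \in verts H.
    by case/and4P: ux => eE _ _; apply: (subsetP (inc_sub eE)).
  have [w [wW wE]] := IHp x xV xp vE.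
  by exists ((e, x) :: w); rewrite /= ux wW.
case=> wW <-; exists (unzip2 w) => //.
elim: w u uV wW => [//|[e x] w IHw] u uV /= /andP[ux xw].
apply/andP; split; first by apply/existsP; exists e.
apply: IHw => //; case/and4P: ux => eE _ _.
exact: (subsetP (inc_sub eE)).
Qed.

Definition components H : {set {set T} * {set U}} :=
  [set (C, [set f in edges H | (inc H f != set0) && (inc H f \subset C)])
     | C : {set T} in equivalence_partition (joinedb H) (verts H)].

Definition omega H : nat := #|components H|.

Lemma del_edge_sub H e f : f \in edges H :\ e -> inc H f \subset verts H.
Proof. by move=> /setD1P[_]; apply: inc_sub. Qed.

Definition del_edge H e : hypergraph T U :=
  Hypergraph (verts_neq0 H) (@del_edge_sub H e).

Definition cut_edge H e : Prop :=
  e \in edges H /\ omega H < omega (del_edge H e).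

Definition hypersubgraph H' H : Prop :=
  [/\ verts H' \subset verts H, edges H' \subset edges H
    & {in edges H', inc H' =1 inc H}].

Definition separating_vertex H v : Prop :=
  exists H1 H2 : hypergraph T U,
    [/\ hypersubgraph H1 H /\ hypersubgraph H2 H,
        connected H1 /\ connected H2,
        edges H1 != set0 /\ edges H2 != set0,
        edges H1 :&: edges H2 = set0 /\ edges H = edges H1 :|: edges H2
      & verts H = verts H1 :|: verts H2 /\ verts H1 :&: verts H2 = [set v]].

End Hypergraph.

(* Main.v *)
Require Import Defs.
From mathcomp Require Import all_boot.

(* Hypergraph cycles are the cycles of length > 2 of the bipartite incidence
   graph on V + E.  Separating vertices and cut edges are exactly the cut nodes
   of that graph, so (1) says that it is 2-connected, and (1) -> (2) is Whitney's
   theorem.  Conversely, all degrees in the incidence graph being at least 2, two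
   nodes separated by a cut node can be moved to neighbours of the desired kind
   (vertices or edges), which a common cycle would connect. *)

Set Implicit Arguments.
Unset Strict Implicit.
Unset Printing Implicit Defensive.


(** * Cycles and node deletion in a symmetric relation *)

Section DelNode.
Variables (N : finType) (g : rel N).

(** The node [z] stays in the type and merely becomes isolated, so statements about the graph
    without [z] must exclude [z] explicitly. *)
Definition del_node (z : N) : rel N :=
  [rel a b | [&& g a b, a != z & b != z]].

Lemma path_del_node z x p :
  x != z -> path (del_node z) x p = path g x p && (z \notin p).
Proof.
elim: p x => [//|y p IHp] x xz; rewrite /= {1}/del_node /= xz inE negb_or [z == y]eq_sym.
by case: eqVneq => [|yz]; rewrite ?andbF //= IHp // andbT andbA.
Qed.

Lemma connect_ind (S : N -> Prop) x y :
  (forall a b, S a -> g a b -> S b) -> connect g x y -> S x -> S y.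
Proof.
move=> Scl /connectP[p + ->]; elim: p x => //= z p IHp x /andP[xz zp] xS.
exact: IHp zp (Scl _ _ xS xz).
Qed.

Hypothesis gC : symmetric g.

Lemma del_node_sym z : symmetric (del_node z).
Proof. by move=> a b; rewrite /del_node /= gC [(b != z) && _]andbC. Qed.

(** A cycle minus one node is still a path: if [z] lies on [c], rotating [z] to the front leaves a
    path through all other nodes; otherwise [c] itself, started at [x], avoids [z]. *)
Lemma ucycle_connect_del_node z c x y :
  ucycle g c -> x \in c -> y \in c -> x != z -> y != z ->
  connect (del_node z) x y.
Proof.
have sC := sym_connect_sym (del_node_sym z).
have from_path a p b : a != z -> path g a p -> z \notin p ->
    b \in a :: p -> connect (del_node z) a b.
  move=> az ap zp /path_connect; apply.
  by rewrite path_del_node // ap.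
case/andP=> cg cU xc yc xz yz; have [zc|zc] := boolP (z \in c); last first.
  have [i c' Ec] := rot_to xc.
  have yc' : y \in x :: c' by rewrite -Ec mem_rot.
  move: cg zc; rewrite -(rot_cycle i) -(mem_rot i) Ec /= rcons_path inE negb_or.
  by case/andP=> xc' _ /andP[_ zc']; apply: from_path yc'.
have [i [|a p] Ec] := rot_to zc.
  by move: xc; rewrite -(mem_rot i) Ec inE (negPf xz).
move: cg cU xc yc; rewrite -(rot_cycle i) -(rot_uniq i) -!(mem_rot i c) Ec.
rewrite ![_ \in z :: _]inE (negPf xz) (negPf yz) /= rcons_path.
rewrite inE negb_or [z == a]eq_sym => /and3P[_ ap _] /andP[/andP[az zp] _] xp yp.
apply: (@connect_trans _ _ a); last exact: from_path yp.
by rewrite sC; apply: from_path xp.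
Qed.

Lemma ucycle_join z p w r y :
  path g z (rcons p w) -> path g w (rcons r y) -> g y z ->
  uniq (z :: p) -> uniq (w :: rcons r y) ->
  ~~ has [in z :: p] (w :: rcons r y) ->
  ucycle g ((z :: p) ++ (w :: rcons r y)).
Proof.
move=> zw wy yz Uz Uw dis; rewrite /ucycle cat_uniq Uz Uw dis !andbT /=.
rewrite -cats1 -catA /= cat_path /=; move: zw; rewrite rcons_path => /andP[-> ->].
by rewrite cats1 rcons_path wy last_rcons.
Qed.

Lemma rev_rcons_path x r y : path g x (rcons r y) = path g y (rcons (rev r) x).
Proof.
have gE : (fun a b => g b a) =2 g by move=> a b; rewrite gC.
have := rev_path g x (rcons r y).
by rewrite last_rcons belast_rcons rev_cons (eq_path gE).
Qed.

(* Follow a path from [z] to [x] avoiding [y] up to its first vertex [w] on the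
   cycle; it replaces the arc from [w] to [y] that does not carry [x]. *)
Lemma ucycle_extend c x y z :
  ucycle g c -> x \in c -> y \in c -> x != y -> g y z ->
  connect (del_node y) z x -> z \notin c ->
  exists c', [/\ ucycle g c', 2 < size c', x \in c' & z \in c'].
Proof.
case/andP=> cg cU xc yc xy yz zx zc.
have zy : z != y by apply: contraNneq zc => ->.
have [i c' Ec] := rot_to yc.
move: cg cU xc zc; rewrite -(rot_cycle i) -(rot_uniq i) -!(mem_rot i c) Ec.
clear i Ec yc c; rewrite [x \in _]inE (negPf xy) /= inE negb_or zy /=.
move=> yc' /andP[yNc Uc'] xc' zc'.
case/connectP: zx => p0 /shortenP[p]; rewrite path_del_node //.
case/andP=> zp yp Up _ Ex.
(* The path ends in [x], which lies on the cycle, so a first meeting point [w] exists. *)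
have hp : has [in c'] p.
  apply/hasP; exists x => //; rewrite Ex; case: (p) Ex => [/= xz|a q _ /=].
    by rewrite -xz xc' in zc'.
  exact: mem_last.
case: (split_find hp) Up zp yp => w p1 p2 /= wc' p1c' Up zp yp.
move: zp Up yp; rewrite cat_path => /andP[zw _].
rewrite -[_ && _]/(uniq ((z :: rcons p1 w) ++ p2)) cat_uniq -rcons_cons.
rewrite rcons_uniq mem_cat mem_rcons inE !negb_or.
case/andP=> /andP[wzp Uzp] _ /andP[/andP[yw yp1] _].
have yzp : y \notin z :: p1 by rewrite inE negb_or eq_sym zy.
have dis s : {subset s <= c'} -> ~~ has [in z :: p1] (rcons s y).
  move=> sc'; apply/hasPn => a; rewrite mem_rcons inE => /predU1P[->//|/sc' ac'].
  rewrite /= inE; apply/norP; split; first by apply: contraNneq zc' => <-.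
  by apply: contra p1c' => ap1; apply/hasP; exists a.
(* Here [r] is the interior of an arc of the old cycle from [w] to [y] that carries [x]; the new
   cycle runs through [z], [p1], [w], [r], [y] and closes by the edge from [y] to [z]. *)
have build r : path g w (rcons r y) -> uniq r -> w \notin r ->
    {subset r <= c'} -> x \in w :: r ->
    exists c', [/\ ucycle g c', 2 < size c', x \in c' & z \in c'].
  move=> wr Ur wr' rc' xr; exists ((z :: p1) ++ (w :: rcons r y)); split.
  - apply: ucycle_join => //.
      rewrite -rcons_cons rcons_uniq inE negb_or yw /= wr' Ur.
      by rewrite !andbT; apply: contra yNc => /rc'.
    rewrite -rcons_cons; apply: dis => a; rewrite inE => /predU1P[->//|].
    exact: rc'.
  - by rewrite size_cat /= size_rcons !addnS addSn.
  - by rewrite mem_cat -rcons_cons mem_rcons inE xr !orbT.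
  - by rewrite inE eqxx.
case/splitPr: wc' dis yc' yNc Uc' xc' zc' p1c' build => q1 q2 _.
rewrite rcons_cat rcons_cons -cat_rcons cat_path last_rcons => /andP[yq1 wq2].
move=> _; rewrite cat_uniq /= negb_or.
case/and3P=> Uq1 /andP[wq1 _] /andP[wNq2 Uq2] xq _ _ build.
have [xq2|xNq2] := boolP (x \in w :: q2).
  by apply: (build q2) => // a aq; rewrite mem_cat inE aq !orbT.
(* Now [x] is in [q1], on the arc from [y] to [w], which is traversed backwards. *)
apply: (build (rev q1)).
- by rewrite -rev_rcons_path.
- by rewrite rev_uniq.
- by rewrite mem_rev.
- by move=> a; rewrite mem_rev mem_cat => ->.
by move: xq; rewrite mem_cat (negPf xNq2) orbF inE mem_rev orbC => ->.
Qed.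

(** Base case of Whitney's theorem: a path from [x'] to [y] avoiding [x] is closed up through [x].
    Since [x'] differs from [y], the cycle has more than two nodes. *)
Lemma ucycle_edge x x' y :
  g x y -> g x x' -> x' != y -> x != y -> x != x' ->
  connect (del_node x) x' y ->
  exists c, [/\ ucycle g c, 2 < size c, x \in c & y \in c].
Proof.
move=> xy xx' x'y xNy xNx' /connectP[p0 /shortenP[p]].
rewrite path_del_node 1?eq_sym // => /andP[x'p xp] Up _ Ey.
have yp : y \in x' :: p by rewrite Ey mem_last.
exists [:: x, x' & p]; split.
- rewrite /ucycle /= xx' rcons_path x'p -Ey gC xy inE negb_or xNx' xp.
  by move: Up.
- by case: (p) Ey x'y => [->|//]; rewrite eqxx.
- exact: mem_head.
- by rewrite inE yp orbT.
Qed.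

(** Whitney's theorem, with [A] as node set of the graph. The existence of a cycle through [x] and
    the current node is propagated along a path from [x]: [ucycle_edge] handles the neighbours of
    [x], and [ucycle_extend] every later step. *)
Lemma ucycle_through (A : {pred N}) x y :
  irreflexive g ->
  (forall a b, g a b -> b \in A) ->
  (forall a b, a \in A -> exists2 a', g a a' & a' != b) ->
  (forall a b c, a \in A -> b \in A -> c \in A -> b != a -> c != a ->
     connect (del_node a) b c) ->
  x \in A -> connect g x y -> x != y ->
  exists c, [/\ ucycle g c, 2 < size c, x \in c & y \in c].
Proof.
move=> gI gA deg nocut xA xy xNy.
pose good z := z != x -> exists c, [/\ ucycle g c, 2 < size c, x \in c & z \in c].
have gN a b : g a b -> a != b by apply: contraTneq => ->; rewrite gI.
suff: good y by apply; rewrite eq_sym.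
apply: connect_ind xy _ => [a b|]; last by rewrite /good eqxx.
have [-> _ xb bNx|aNx /(_ aNx)[c [cU c3 xc ac]] ab bNx] := eqVneq a x.
  have [x' xx' x'b] := deg x b xA.
  apply: (ucycle_edge xb xx' x'b (gN _ _ xb) (gN _ _ xx')).
  by apply: nocut xA (gA _ _ xx') (gA _ _ xb) _ _; rewrite eq_sym gN.
have [bc|bc] := boolP (b \in c); first by exists c.
apply: (ucycle_extend cU xc ac _ ab _ bc); rewrite 1?eq_sym //.
have aA : a \in A by apply: (gA b); rewrite gC.
by apply: (nocut _ _ _ aA (gA _ _ ab) xA); rewrite eq_sym // gN.
Qed.
End DelNode.


(** This makes the condition [u != v] of [adj_via] automatic on cycles, whose vertices are distinct
    up to closing. *)
Lemma path_neq_rcons (T : eqType) (x : T) s :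
  0 < size s -> uniq (x :: s) -> path (fun a b => a != b) x (rcons s x).
Proof.
case: s => // y s _ xs; rewrite rcons_path.
have -> /= : path (fun a b => a != b) x (y :: s).
  by move: xs; rewrite uniq_pairwise => /pairwise_sorted.
by apply: contraTneq xs => <-; rewrite cons_uniq mem_last.
Qed.

(** * Walks, cycles and components in the incidence graph *)

Section Incidence.
Variables T U : finType.
Implicit Types (H : hypergraph T U) (w : seq (U * T)).

Definition incident H : rel (T + U) := fun x y =>
  match x, y with
  | inl v, inr e | inr e, inl v => (e \in edges H) && (v \in inc H e)
  | _, _ => false
  end.

Lemma incident_sym H : symmetric (incident H).
Proof. by case=> [a|e] [b|f]. Qed.

Lemma incident_irr H : irreflexive (incident H).
Proof. by case. Qed.

Lemma incident_elements H x y : incident H x y -> y \in elements H.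
Proof.
case: x y => [a|e] [b|f] //= /andP[eE]; rewrite inE //.
exact/subsetP/inc_sub.
Qed.

(** The starting vertex is left out, so that a closed walk lists it only once, at the end. *)
Definition alternate w : seq (T + U) :=
  flatten [seq [:: inr p.1; inl p.2] | p <- w].

Lemma last_alternate v w : last (inl v) (alternate w) = inl (walk_end v w).
Proof. by elim: w v => //= -[e t] w IHw v /=; rewrite IHw. Qed.

Lemma mem_alternate w x :
  x \in alternate w = match x with
                      | inl v => v \in unzip2 w
                      | inr e => e \in unzip1 w
                      end.
Proof.
elim: w => [|[e t] w IHw]; first by case: x.
by rewrite !inE -/(alternate w) IHw; case: x {IHw}.
Qed.

Lemma uniq_alternate w :
  uniq (alternate w) = uniq (unzip1 w) && uniq (unzip2 w).
Proof.
elim: w => //= -[e t] w IHw /=.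
by rewrite inE !mem_alternate IHw /= -!andbA; congr andb; rewrite andbCA.
Qed.

Lemma size_alternate w : size (alternate w) = (size w).*2.
Proof. by elim: w => //= p w ->. Qed.

(** The graph is bipartite, so a path between vertices can be read off two nodes at a time; hence
    the induction on a bound for the size. *)
Lemma path_incident_alternate H v s v' :
  path (incident H) (inl v) s -> last (inl v) s = inl v' ->
  exists w, s = alternate w.
Proof.
have [n] := ubnP (size s); elim: n v s => // n IHn v [|[//|e] [|[t|//] s]] //=.
- by exists [::].
- rewrite ltnS => /ltnW sn /and3P[_ _ /IHn] /[apply]-[//|w ->].
  by exists ((e, t) :: w).
- by rewrite andbF.
Qed.

(** The second conjunct is needed because an incidence path may go from a vertex to an edge and
    straight back, which [adj_via] forbids. *)
Lemma walk_alternate H v w : v \in verts H ->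
  walk H v w =
    path (incident H) (inl v) (alternate w)
    && path (fun a b => a != b) v (unzip2 w).
Proof.
elim: w v => //= -[e t] w IHw v vV /=; rewrite /adj_via /=.
have [eE|] := boolP (e \in edges H); rewrite ?andbF //=.
have [te|] := boolP (t \in inc H e); rewrite ?andbF //=.
rewrite IHw ?(subsetP (inc_sub eE)) //.
by case: (v != t); case: (v \in _); rewrite ?andbF ?andbT.
Qed.

Lemma is_cycle_alternate H v w : v \in verts H ->
  is_cycle H v w =
    [&& path (incident H) (inl v) (alternate w), 2 <= size w,
        walk_end v w == v & uniq (alternate w)].
Proof.
move=> vV; rewrite /is_cycle walk_alternate // -andbA; congr andb.
rewrite /walk_end uniq_alternate.
case/lastP: w => [|w [e t]]; first by rewrite /= ?andbF.
rewrite /unzip1 /unzip2 !map_rcons size_rcons last_rcons belast_rcons /=.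
have [->|] := eqVneq t v; rewrite ?andbF //=.
rewrite !rcons_uniq; case: w => [|p w]; first by rewrite /= ?andbF.
set vw := (_ \notin _) && uniq (map snd _).
have [vU|_] := boolP vw; last by rewrite !andbF.
by rewrite (path_neq_rcons _ vU) //= andbT.
Qed.

Lemma lies_on_alternate v w x : 0 < size w -> walk_end v w = v ->
  lies_on v w x = (x \in alternate w).
Proof.
case: w => // p w _ wv; rewrite mem_alternate; case: x => //= a.
rewrite inE; case: eqVneq => [->|//].
by have := mem_last p.2 (unzip2 w); rewrite [last _ _]wv => ->.
Qed.

(** A closed walk of k steps gives 2k nodes, so k >= 2 amounts to a size above 2. This rules out the
    degenerate [ucycle] of size 2, which runs along one incidence back and forth. *)
Lemma common_cycleP H x y :
  on_common_cycle H x y <->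
  exists c, [/\ ucycle (incident H) c, 2 < size c, x \in c & y \in c].
Proof.
have cycE v w : walk_end v w = v -> 0 < size w ->
    cycle (incident H) (alternate w) = path (incident H) (inl v) (alternate w).
  move=> + w0; have := last_alternate v w; have := size_alternate w.
  case/lastP: (alternate w) => [|s z] /=; first by case: (w) w0.
  by rewrite last_rcons => _ -> ->; rewrite -[in LHS]rot1_cons rot_cycle.
split=> [[v [w [wC xw yw]]]|[c [cU c3 xc yc]]].
  have vV : v \in verts H.
    case/and3P: wC; case: w {xw yw} => // -[e t] w /= /andP[+ _] _ _.
    by case/and4P=> eE _ ve _; apply: (subsetP (inc_sub eE)).
  move: wC; rewrite is_cycle_alternate // => /and4P[wp w2 /eqP wv wU].
  have w0 : 0 < size w by apply: ltnW.
  exists (alternate w); rewrite -!(lies_on_alternate _ w0 wv); split=> //.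
    by rewrite /ucycle (cycE v) ?wp.
  by rewrite size_alternate -(leq_double 2) in w2 *; apply: leq_trans w2.
(* By bipartiteness, one of the first two nodes is a vertex. *)
have [v vc] : exists v, inl v \in c.
  case: c cU c3 {xc yc} => [//|[v|e] [//|b c]]; first by exists v; rewrite mem_head.
  by case: b => [v|f] /andP[] //=; exists v; rewrite !inE eqxx.
case/andP: cU => cg cU; have [i s Es] := rot_to vc.
move: cg cU c3 xc yc.
rewrite -(rot_cycle i) -(rot_uniq i) -(size_rot i) -!(mem_rot i c) Es.
(* One more rotation moves [inl v] from the front to the end, where [alternate] puts it. *)
rewrite -(rot_uniq 1) -(size_rot 1) -!(mem_rot 1 (_ :: s)) rot1_cons /= => sp.
have [w Ew] := path_incident_alternate sp (last_rcons _ _ _).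
have wv : walk_end v w = v.
  by have := last_alternate v w; rewrite -Ew last_rcons => -[].
move: sp; rewrite {}Ew size_alternate => sp sU s3 xs ys.
have w2 : 1 < size w by case: (size w) s3 => [|[]].
have w0 : 0 < size w by apply: ltnW.
have vV : v \in verts H.
  case: w sp w0 {xs ys w2 s3 sU wv} => // -[e t] w /= /andP[/andP[eE ve] _] _.
  by apply: (subsetP (inc_sub eE)).
exists v, w; rewrite !lies_on_alternate //; split=> //.
by rewrite is_cycle_alternate // sp w2 wv eqxx.
Qed.

Lemma connect_incident H u v : u \in verts H ->
  connect (incident H) (inl u) (inl v) = joinedb H u v.
Proof.
move=> uV; apply/idP/idP => uv.
  (* An edge counts as reached from [u] once one of its vertices is. *)
  pose S (x : T + U) : Prop := match x with
    | inl t => joinedb H u t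
    | inr e => exists2 t, t \in inc H e & joinedb H u t
    end.
  apply: (connect_ind (S := S) _ uv (connect0 _ _)).
  case=> [a|e] [b|f] //=; first by move=> ua /andP[_ aE]; exists a.
  case=> t te ut /andP[eE be]; apply: connect_trans ut _.
  have [->|tb] := eqVneq t b; first exact: connect0.
  by apply: connect1; apply/existsP; exists e; rewrite /adj_via eE tb te be.
apply: (connect_ind (S := fun t => connect (incident H) (inl u) (inl t)) _ uv) => //.
move=> a b ua /existsP[e /and4P[eE _ ae be]].
apply: connect_trans ua (connect_trans (y := inr e) _ _).
  by apply: connect1; rewrite /= eE.
by apply: connect1; rewrite /= eE.
Qed.

Lemma incident_del_edge H e :
  incident (del_edge H e) =2 del_node (incident H) (inr e).
Proof.
have E (f : U) : (inr f != inr e :> T + U) = (f != e) by [].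
by case=> [a|f] [b|f'] //; rewrite /del_node /= in_setD1 E ?andbT -andbA andbC
  -?andbA; do ?bool_congr.
Qed.

Lemma connected_joinedb H u v :
  connected H -> u \in verts H -> v \in verts H -> joinedb H u v.
Proof.
move=> HC uV vV; have [->|uv] := eqVneq u v; first exact: connect0.
exact/joinedP/HC.
Qed.

Lemma joinedb_sym H : symmetric (joinedb H).
Proof.
apply: sym_connect_sym => a b; apply: eq_existsb => e.
by rewrite /adj_via eq_sym [(a \in _) && _]andbC.
Qed.

(** A component is determined by its vertex class, so having at most one component means having at
    most one class. *)
Lemma omega_le1 H :
  (omega H <= 1) <-> {in verts H &, forall u v, joinedb H u v}.
Proof.
split=> [/card_le1_eqP H1 u v uV vV|HC].
  set D := fun z : T => [set t in verts H | joinedb H z t].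
  have DE z : z \in verts H ->
      (D z, [set f in edges H | (inc H f != set0) && (inc H f \subset D z)])
        \in components H.
    by move=> zV; apply/imsetP; exists (D z) => //; apply: imset_f.
  have [/setP/(_ v)] := H1 _ _ (DE u uV) (DE v vV).
  by rewrite !inE vV /= [joinedb H v v]connect0.
apply/card_le1_eqP => C1 C2 /imsetP[_ /imsetP[u uV ->] ->].
move=> /imsetP[_ /imsetP[v vV ->] ->].
suff -> : [set y in verts H | joinedb H u y] = [set y in verts H | joinedb H v y].
  by [].
by apply/setP=> t; rewrite !inE; case tV: (t \in _); rewrite //= !HC.
Qed.

Lemma omega_gt0 H : 0 < omega H.
Proof.
by rewrite card_gt0 imset_eq0 imset_eq0 verts_neq0.
Qed.

(** As [omega H] is 1, the count grows exactly when [del_edge H e] has more than one class. *)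
Lemma cut_edgeP H e : connected H -> e \in edges H ->
  cut_edge H e <->
  exists u v, [/\ u \in verts H, v \in verts H &
    ~~ connect (del_node (incident H) (inr e)) (inl u) (inl v)].
Proof.
move=> HC eE.
have H1 : omega H <= 1.
  by apply/omega_le1 => u v uV vV; apply: connected_joinedb.
have E u v : u \in verts H ->
    connect (del_node (incident H) (inr e)) (inl u) (inl v)
      = joinedb (del_edge H e) u v.
  by move=> uV; rewrite -(connect_incident (H := del_edge H e)) //;
     apply/esym/eq_connect/incident_del_edge.
have sub : omega (del_edge H e) <= 1 <->
    {in verts H &, forall u v,
      connect (del_node (incident H) (inr e)) (inl u) (inl v)}.
  split=> [/omega_le1 D u v uV vV|D]; first by rewrite E // D.
  by apply/omega_le1 => u v uV vV; rewrite -E // D.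
split=> [[_ He]|[u [v [uV vV uv]]]].
  (* Deciding the boolean form allows the unconnected pair to be extracted constructively. *)
  have [/'forall_in_forall_inP D|] := boolP
    [forall u in verts H, forall v in verts H,
      connect (del_node (incident H) (inr e)) (inl u) (inl v)].
    have /sub : {in verts H &, forall u v,
      connect (del_node (incident H) (inr e)) (inl u) (inl v)}.
      by move=> u v uV vV; apply: D.
    by rewrite leqNgt (leq_trans _ He) ?ltnS ?omega_gt0.
  rewrite negb_forall_in => /exists_inP[u uV].
  by rewrite negb_forall_in => /exists_inP[v vV uv]; exists u, v.
split=> //; apply: leq_ltn_trans H1 _; rewrite ltnNge.
by apply/negP => /sub/(_ u v uV vV); apply/negP.
Qed.

End Incidence.


(** * Cut nodes against separating vertices and cut edges *)

Section Cut.
Variables T U : finType.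
Implicit Types H : hypergraph T U.

(** The restriction to [elements H] discards labels outside [H], which are isolated in the incidence
    graph. *)
Definition cut_node H z : Prop :=
  exists x y, [/\ x \in elements H, y \in elements H, x != z, y != z
    & ~~ connect (del_node (incident H) z) x y].

(** One edge is taken from each side: a path that avoids [v] can never leave [H1]. *)
Lemma separating_cut_node H v : separating_vertex H v -> cut_node H (inl v).
Proof.
move=> [H1 [H2 [[[_ E1 I1] [_ _ I2]] _ [/set0Pn[e e1] /set0Pn[f f2]]]]].
move=> [E12 EE] [_ V12]; exists (inr e), (inr f); rewrite !inE EE !inE e1 f2 orbT.
split=> //; apply/negP => ef.
pose S (x : T + U) : Prop := match x with
  | inl t => t \in verts H1
  | inr g => g \in edges H1
  end.
suff: S (inr f) by move=> f1; have := in_set0 f; rewrite -E12 inE f1 f2.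
apply: (connect_ind (S := S) _ ef) => // -[t|g] [t'|g'] //=.
  move=> t1 /and3P[/andP[gE tg] tv _]; move: gE; rewrite EE inE.
  case/orP=> // g2; case/negP: tv; apply/eqP; congr inl; apply/set1P.
  by rewrite -V12 inE t1 (subsetP (inc_sub g2)) // I2.
move=> g1 /and3P[/andP[_ tg] _ _].
by apply: (subsetP (inc_sub g1)); rewrite I1.
Qed.

(** Here [S] is a union of components of the incidence graph without [v]. Adding [v] back makes it
    connected, because a path in [H] from [S] to [v] stays in [S] until it first meets [v]. *)
Lemma hypersubgraph_branch H v (S : {set T + U}) :
  connected H -> v \in verts H -> S \subset elements H -> inl v \notin S ->
  (forall a b, a \in S -> incident H a b -> b != inl v -> b \in S) ->
  exists H', [/\ hypersubgraph H' H, connected H',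
    verts H' = v |: [set t | inl t \in S] & edges H' = [set e | inr e \in S]].
Proof.
move=> HC vV /subsetP SH vS Scl.
have V0 : v |: [set t | inl t \in S] != set0.
  by apply/set0Pn; exists v; rewrite setU11.
have iS e : e \in [set e | inr e \in S] ->
    inc H e \subset v |: [set t | inl t \in S].
  rewrite inE => eS; apply/subsetP=> t te; rewrite !inE.
  have [//|tv] := eqVneq t v; apply: (Scl _ _ eS) => //=.
  by have := SH _ eS; rewrite inE te andbT.
pose H' := Hypergraph V0 iS.
have HS : hypersubgraph H' H.
  split=> //; apply/subsetP => a; rewrite !inE.
    by case/predU1P=> [->//|/SH]; rewrite inE.
  by move/SH; rewrite inE.
have to_v t : t \in verts H' -> joinedb H' t v.
  move=> tV'; have tV : t \in verts H by case: HS => /subsetP-> .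
  rewrite -connect_incident //.
  have: connect (incident H) (inl t) (inl v).
    by rewrite connect_incident // connected_joinedb.
  case/connectP=> p.
  have: (inl t == inl v :> T + U) || (inl t \in S) by move: tV'; rewrite !inE.
  elim: p (inl t : T + U) => [|b p IHp] a aS /=; first by move=> _ <-.
  case/andP=> ab bp bE; case/predU1P: aS => [->//|aS].
  have bS : (b == inl v) || (b \in S).
    by have [//|bv] := eqVneq b (inl v); apply: (Scl _ _ aS ab bv).
  apply: connect_trans (IHp b bS bp bE); apply: connect1.
  case: a b ab aS bS {bp bE} => [u|e] [w|f] //= /andP[_ ->].
    by move=> _ fS; rewrite inE andbT.
  by move=> eS _; rewrite inE eS.
exists H'; split=> // s t sV tV _; apply/joinedP => //.
by apply: connect_trans (to_v s sV) _; rewrite -/(joinedb _ _ _) joinedb_sym to_v.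
Qed.

Section Dense.
Variable H : hypergraph T U.
Hypotheses (Hconn : connected H)
  (Hedge : forall e : U, e \in edges H -> 2 <= #|inc H e|)
  (Hdeg : forall v : T, v \in verts H -> 2 <= degree H v).

Lemma other_neighbour x z : x \in elements H ->
  exists2 y, incident H x y & y != z.
Proof.
have other (I : finType) (A : {set I}) a : 1 < #|A| -> exists2 b, b \in A & b != a.
  case/card_gt1P=> b [c [bA cA bc]]; have [Eb|] := eqVneq b a; last by exists b.
  by exists c => //; rewrite -Eb eq_sym.
case: x => [v|e]; rewrite inE.
  move/Hdeg => v2; case: z => [u|f].
    have /card_gt0P[e] : 0 < degree H v by apply: ltnW.
    by rewrite inE => ve; exists (inr e).
  by have [e] := other _ _ f v2; rewrite inE => ve ef; exists (inr e).
move=> eE; have e2 := Hedge eE; case: z => [u|f].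
  by have [v ve vu] := other _ _ u e2; exists (inl v); rewrite //= eE.
have /card_gt0P[v ve] : 0 < #|inc H e| by apply: ltnW.
by exists (inl v); rewrite //= eE.
Qed.

Lemma connect_elements x y : x \in elements H -> y \in elements H ->
  connect (incident H) x y.
Proof.
have to_vert z : z \in elements H ->
    exists2 v, v \in verts H & connect (incident H) z (inl v).
  case: z => [v|e] zE; first by exists v; [rewrite inE in zE|exact: connect0].
  have [[v|//] ev _] := other_neighbour (inr e) zE.
  exists v; last exact: connect1.
  by have := incident_elements ev; rewrite inE.
move=> /to_vert[u uV xu] /to_vert[v vV yv]; apply: connect_trans xu _.
rewrite (sym_connect_sym (@incident_sym _ _ H)); apply: connect_trans yv _.
by rewrite connect_incident ?connected_joinedb.
Qed.

(** The set [P] is a cover of the incidences, in practice all vertices or all edges. A separated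
    node outside [P] is replaced by a neighbour other than [z], which lies on the same side. *)
Lemma cut_node_neighbours z (P : {pred T + U}) :
  (forall a b, incident H a b -> (a \in P) || (b \in P)) ->
  cut_node H z ->
  exists x y, [/\ x \in elements H, y \in elements H, x \in P, y \in P &
    [/\ x != z, y != z & ~~ connect (del_node (incident H) z) x y]].
Proof.
move=> HP [x [y [xE yE xz yz xy]]].
have sC := sym_connect_sym (del_node_sym (@incident_sym _ _ H) z).
have toP a : a \in elements H -> a != z -> exists b,
    [/\ b \in elements H, b \in P, b != z
      & connect (del_node (incident H) z) a b].
  move=> aE az; have [aP|aP] := boolP (a \in P).
    by exists a; split=> //; apply: connect0.
  have [b ab bz] := other_neighbour z aE.
  have := HP _ _ ab; rewrite (negPf aP) => bP.
  exists b; split=> //; first exact: incident_elements ab.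
  by apply: connect1; apply/and3P.
have [x' [x'E x'P x'z xx']] := toP x xE xz.
have [y' [y'E y'P y'z yy']] := toP y yE yz.
exists x', y'; split=> //; split=> //; apply: contra xy => x'y'.
by apply: connect_trans xx' (connect_trans x'y' _); rewrite sC.
Qed.

Lemma cut_edge_cut_node e : e \in edges H ->
  cut_edge H e <-> cut_node H (inr e).
Proof.
move=> eE; split.
  case/cut_edgeP=> // u [v [uV vV uv]]; exists (inl u), (inl v).
  by rewrite !inE.
pose P : {pred T + U} := [pred x | if x is inl _ then true else false].
have HP a b : incident H a b -> (a \in P) || (b \in P) by case: a b => [a|f] [].
case/(cut_node_neighbours HP) => -[u|f] [[v|g]] [uV vV // _ _ [_ _ uv]].
rewrite !inE in uV vV.
by apply/cut_edgeP => //; exists u, v.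
Qed.

Lemma cut_node_separating v :
  v \in verts H -> cut_node H (inl v) -> separating_vertex H v.
Proof.
move=> vV [x [y [xE yE xv yv xy]]].
set g := del_node (incident H) (inl v) in xy.
have gC := del_node_sym (@incident_sym _ _ H) (inl v).
have sC := sym_connect_sym gC.
have gE a b : incident H a b -> a != inl v -> b != inl v -> connect g a b.
  by move=> ab av bv; apply: connect1; apply/and3P.
(* [S1] is the component of [x] without [v], and [S2] collects all other components; each spans one
   of the two hypersubgraphs once [v] is added. *)
pose S1 := [set a | connect g x a].
pose S2 := [set a in elements H | (a != inl v) && ~~ connect g x a].
have S1E a : a \in S1 -> (a \in elements H) && (a != inl v).
  rewrite inE => xa.
  apply: (connect_ind (S := fun a => (a \in elements H) && (a != inl v)) _ xa).
    by move=> b c _ /and3P[/incident_elements-> _ ->].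
  by rewrite xE.
have S1cl a b : a \in S1 -> incident H a b -> b != inl v -> b \in S1.
  move=> aS ab bv; have /andP[_ av] := S1E _ aS.
  by move: aS; rewrite !inE => xa; apply: connect_trans xa (gE _ _ ab av bv).
have S2cl a b : a \in S2 -> incident H a b -> b != inl v -> b \in S2.
  rewrite inE => /and3P[_ av xa] ab bv.
  rewrite inE (incident_elements ab) bv /=; apply: contra xa => xb.
  by apply: connect_trans xb _; rewrite sC; apply: gE.
have [||H1 [sH1 cH1 VH1 EH1]] := hypersubgraph_branch Hconn vV _ _ S1cl.
- by apply/subsetP => a /S1E /andP[].
- by apply/negP => /S1E; rewrite eqxx andbF.
have [||H2 [sH2 cH2 VH2 EH2]] := hypersubgraph_branch Hconn vV _ _ S2cl.
- by apply/subsetP => a; rewrite inE => /andP[].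
- by rewrite inE eqxx andbF.
(* If [a] is a vertex, each of its neighbours is an edge, hence not [inl v], and so belongs to the
   branch. *)
have has_edge (S : {set T + U}) a :
    (forall b c, b \in S -> incident H b c -> c != inl v -> c \in S) ->
    a \in S -> a \in elements H -> [set e | inr e \in S] != set0.
  move=> Scl aS aE; apply/set0Pn; case: a aS aE => [t|e] aS aE.
    have [[//|e] te ev] := other_neighbour (inl v) aE.
    by exists e; rewrite inE; apply: (Scl _ _ aS te ev).
  by exists e; rewrite inE.
exists H1, H2; split=> //.
- rewrite EH1 EH2 (has_edge _ x S1cl) ?(has_edge _ y S2cl) //.
    by rewrite inE yE yv.
  by rewrite inE connect0.
- rewrite EH1 EH2; split; apply/setP => e; rewrite !inE.
    by case: (connect _ _ _); rewrite ?andbF.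
  have := @S1E (inr e); rewrite !inE andbT.
  by case: (connect _ _ _) => [->//|_]; rewrite andbT.
rewrite VH1 VH2; split; apply/setP => t; rewrite !inE.
  have := @S1E (inl t); rewrite !inE; have [->|tv] := eqVneq t v.
    by rewrite vV.
  have tv' : inl t != inl v :> T + U by [].
  by rewrite tv' /= !andbT; case: (connect _ _ _) => [->//|_]; rewrite andbT.
have [//|tv] := eqVneq t v.
by case: (connect _ _ _); rewrite ?andbF.
Qed.
Lemma no_cut_node_of_cycles z (P : {pred T + U}) :
  (forall a b, incident H a b -> (a \in P) || (b \in P)) ->
  {in elements H &, forall x y, x \in P -> y \in P -> x != y ->
     on_common_cycle H x y} ->
  ~ cut_node H z.
Proof.
move=> HP cyc /(cut_node_neighbours HP)[x [y [xE yE xP yP [xz yz]]]].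
have [->|xy] := eqVneq x y; first by rewrite connect0.
have /common_cycleP[c [cU _ xc yc]] := cyc x y xE yE xP yP xy.
case/negP; exact: (ucycle_connect_del_node (@incident_sym _ _ H) cU).
Qed.

Lemma no_cut_nodeP :
  (forall z, z \in elements H -> ~ cut_node H z) <->
  (forall v, v \in verts H -> ~ separating_vertex H v) /\
  (forall e, e \in edges H -> ~ cut_edge H e).
Proof.
split=> [nc|[nv ne]].
  split=> [v vV /separating_cut_node|e eE /cut_edge_cut_node].
    by apply: nc; rewrite inE.
  by move=> /(_ eE); apply: nc; rewrite inE.
case=> [v|e]; rewrite inE => zE.
  by move/(cut_node_separating zE); apply: nv.
by move/(cut_edge_cut_node zE); apply: ne.
Qed.

Lemma no_cut_node_common_cycle x y :
  (forall z, z \in elements H -> ~ cut_node H z) ->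
  x \in elements H -> y \in elements H -> x != y -> on_common_cycle H x y.
Proof.
move=> nc xE yE xy; apply/common_cycleP.
apply: (ucycle_through (@incident_sym _ _ H) (A := mem (elements H))) => //.
- exact: incident_irr.
- exact: incident_elements.
- by move=> a b; apply: other_neighbour.
- move=> a b c aE bE cE ba ca; apply/negPn/negP => bc.
  by apply: (nc a aE); exists b, c.
exact: connect_elements.
Qed.
End Dense.
End Cut.

(** * The cycle of implications *)

Unset Implicit Arguments.

Theorem theorem3p46 (T U : finType) (H : hypergraph T U)
  (Hconn : connected H)
  (HV : 2 <= #|verts H|)
  (Hedge : forall e : U, e \in edges H -> 2 <= #|inc H e|)
  (Hdeg : forall v : T, v \in verts H -> 2 <= degree H v) :
  [<-> (forall v : T, v \in verts H -> ~ separating_vertex H v) /\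
         (forall e : U, e \in edges H -> ~ cut_edge H e);
       forall x y : T + U, x \in elements H -> y \in elements H -> x != y ->
         on_common_cycle H x y;
       forall u v : T, u \in verts H -> v \in verts H -> u != v ->
         on_common_cycle H (inl u) (inl v);
       forall e f : U, e \in edges H -> f \in edges H -> e != f ->
         on_common_cycle H (inr e) (inr f)].
Proof.
have nocut := no_cut_nodeP Hconn Hedge Hdeg.
tfae.
- by move=> /nocut nc x y; apply: no_cut_node_common_cycle.
- by move=> cyc u v uV vV uv; apply: cyc; rewrite ?inE.
(* Cycles through vertex pairs exclude cut nodes, with the vertices as cover [P]; Whitney's theorem
   then gives cycles through edge pairs. *)
- move=> cyc e f eE fE ef.
  apply: no_cut_node_common_cycle; rewrite ?inE // => z _.
  apply: (no_cut_node_of_cycles Hedge Hdeg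
    (P := [pred x : T + U | if x is inl _ then true else false])).
    by case=> [a|e'] [].
  case=> [u|//] [v|//]; rewrite !inE => uV vV _ _ uv; exact: cyc.
(* The same exclusion, with the edges as cover. *)
move=> cyc; apply/nocut => z _.
apply: (no_cut_node_of_cycles Hedge Hdeg
  (P := [pred x : T + U | if x is inr _ then true else false])).
  by case=> [a|e] [].
case=> [//|e] [//|f]; rewrite !inE => eE fE _ _ ef; exact: cyc.
Qed.
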